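(* Let $n_1,\ldots,n_d$ be positive integers and let $\eta$ be a $(d-2)$-dimensional partition with $D(\eta)\subseteq[n_2]\times\cdots\times[n_d]$. Let $D(n_1\times\eta)=\{(i,\mathbf{i}): i\in[n_1],\ \mathbf{i}\in D(\eta)\}\subset\mathbb{Z}_+^d$. Then $$\sum_{\rho} g_{\rho}(\mathbf{x}^{(1)}; \ldots; \mathbf{x}^{(d)}) = \prod_{(i_1,\ldots, i_d) \in D(n_1 \times \eta)} \left(1 - x^{(1)}_{i_1} \cdots x^{(d)}_{i_d} \right)^{-1},$$ where the sum runs over all $(d-1)$-dimensional partitions $\rho$ with $\mathrm{sh}(\rho)\subseteq D(\eta)$.
   Context: A $k$-dimensional partition is an array $\pi=(\pi_{\mathbf{i}})_{\mathbf{i}\in\mathbb{Z}_+^k}$ of nonnegative integers with finitely many nonzero entries, weakly decreasing in each coordinate; its diagram is $D(\pi)=\{(\mathbf{i},i)\in\mathbb{Z}_+^{k+1}:1\le i\le\pi_{\mathbf{i}}\}$ and its shape $\mathrm{sh}(\pi)=\{\mathbf{i}:\pi_{\mathbf{i}}>0\}$. For a $d$-dimensional partition $\pi$: $\mathrm{Cor}(\pi)=\{\mathbf{i}\in D(\pi):\mathbf{i}+\mathbf{e}_\ell\notin D(\pi)\ \forall\ell\in[d]\}$ ($\mathbf{e}_\ell$ standard basis of $\mathbb{Z}^{d+1}$), and $\mathrm{sh}_1(\pi)=\{(i_2,\ldots,i_{d+1}):(i_1,\ldots,i_{d+1})\in D(\pi)\}\subset\mathbb{Z}_+^d$. Variables: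 $\mathbf{x}^{(k)}=(x^{(k)}_1,\ldots,x^{(k)}_{n_k})$, $k\in[d]$. For a $(d-1)$-dimensional partition $\rho$ with $D(\rho)\subseteq[n_2]\times\cdots\times[n_d]\times\mathbb{Z}_+$, the $d$-dimensional Grothendieck polynomial is $g_\rho(\mathbf{x}^{(1)};\ldots;\mathbf{x}^{(d)})=\sum_{\pi}\prod_{(i_1,\ldots,i_{d+1})\in\mathrm{Cor}(\pi)}x^{(1)}_{i_1}\cdots x^{(d)}_{i_d}$, summed over $d$-dimensional partitions $\pi$ with $D(\pi)\subseteq[n_1]\times\cdots\times[n_d]\times\mathbb{Z}_+$ and $\mathrm{sh}_1(\pi)=D(\rho)$. *)

(* Defs.v *)
From HB Require Import structures.
From mathcomp Require Import all_boot all_order all_algebra.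
From mathcomp Require Import finmap.
From mathcomp Require Import boolp classical_sets cardinality fsbigop.
From mathcomp Require Import mpoly.

Set Implicit Arguments.
Unset Strict Implicit.
Unset Printing Implicit Defensive.

Import GRing.Theory.
Local Open Scope fset_scope.
Local Open Scope ring_scope.

Record fps (n : nat) (R : Type) := FPS { fps_coef : 'X_{1..n} -> R }.

Section FPSRing.
Variables (n : nat) (R : comNzRingType).
Implicit Types f g h : fps n R.

HB.instance Definition _ := gen_eqMixin (fps n R).
HB.instance Definition _ := gen_choiceMixin (fps n R).

Lemma fpsP f g : (forall m, fps_coef f m = fps_coef g m) -> f = g.
Proof. by case: f g => [f] [g] /= /funext ->. Qed.

Definition fps_zero : fps n R := FPS (fun=> 0).
Definition fps_one : fps n R := FPS (fun m => (m == 0%MM)%:R).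
Definition fps_opp f : fps n R := FPS (fun m => - fps_coef f m).
Definition fps_add f g : fps n R := FPS (fun m => fps_coef f m + fps_coef g m).

(* Cauchy product; both components of [k] range over the (finite) type of
   monomials of degree at most [mdeg m]. *)
Definition fps_mul f g : fps n R := FPS (fun m =>
  \sum_(k : 'X_{1..n < (mdeg m).+1, (mdeg m).+1} | m == (k.1 + k.2)%MM)
     fps_coef f k.1 * fps_coef g k.2).

Fact fps_addA : associative fps_add.
Proof. by move=> f g h; apply: fpsP => m; rewrite /= addrA. Qed.
Fact fps_addC : commutative fps_add.
Proof. by move=> f g; apply: fpsP => m; rewrite /= addrC. Qed.
Fact fps_add0 : left_id fps_zero fps_add.
Proof. by move=> f; apply: fpsP => m; rewrite /= add0r. Qed.
Fact fps_addN : left_inverse fps_zero fps_opp fps_add.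
Proof. by move=> f; apply: fpsP => m; rewrite /= addNr. Qed.

HB.instance Definition _ := GRing.isZmodule.Build (fps n R)
  fps_addA fps_addC fps_add0 fps_addN.

Definition fps_of_mpoly (p : {mpoly R[n]}) : fps n R := FPS (fun m => p@_m).

Let trunc (b : nat) f : {mpoly R[n]} :=
  \sum_(m : 'X_{1..n < b}) fps_coef f m *: 'X_[m].

Let truncE b f m : (mdeg m < b)%N -> (trunc b f)@_m = fps_coef f m.
Proof. exact: mcoeff_mpoly. Qed.

Let eq_mcoeffM (p q : {mpoly R[n]}) f g m :
    (forall m', (mdeg m' <= mdeg m)%N -> p@_m' = fps_coef f m') ->
    (forall m', (mdeg m' <= mdeg m)%N -> q@_m' = fps_coef g m') ->
  (p * q)@_m = fps_coef (fps_mul f g) m.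
Proof.
move=> pf qg; rewrite mcoeffM /=; apply: eq_bigr => k _.
by rewrite pf ?qg // -ltnS ?bmdeg.
Qed.

Let mul_truncE b f g m : (mdeg m < b)%N ->
  (trunc b f * trunc b g)@_m = fps_coef (fps_mul f g) m.
Proof.
by move=> mb; apply: eq_mcoeffM => m' m'm; apply: truncE; apply: leq_ltn_trans mb.
Qed.

Fact fps_mulA : associative fps_mul.
Proof.
move=> f g h; apply: fpsP => m; pose b := (mdeg m).+1.
have lt_b m' : (mdeg m' <= mdeg m)%N -> (mdeg m' < b)%N by rewrite ltnS.
transitivity ((trunc b f * (trunc b g * trunc b h))@_m).
  by symmetry; apply: eq_mcoeffM => m' /lt_b ?; rewrite ?truncE ?mul_truncE.
by rewrite mulrA; apply: eq_mcoeffM => m' /lt_b ?; rewrite ?truncE ?mul_truncE.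
Qed.

Fact fps_mulC : commutative fps_mul.
Proof.
move=> f g; apply: fpsP => m; have lt_mb := ltnSn (mdeg m).
by rewrite -!(mul_truncE _ _ lt_mb) mulrC.
Qed.

Fact fps_mul1 : left_id fps_one fps_mul.
Proof.
move=> f; apply: fpsP => m; have lt_mb := ltnSn (mdeg m).
rewrite -(truncE f lt_mb) -[RHS](congr1 (mcoeff m) (mul1r _)).
symmetry; apply: eq_mcoeffM => m' m'm; first by rewrite mcoeff1.
by rewrite truncE.
Qed.

Fact fps_mulDl : left_distributive fps_mul fps_add.
Proof.
move=> f g h; apply: fpsP => m /=; rewrite -big_split /=.
by apply: eq_bigr => k _; rewrite mulrDl.
Qed.

Fact fps_oner_neq0 : fps_one != 0 :> fps n R.
Proof.
apply/eqP => /(congr1 (fun f => fps_coef f 0%MM)) /= /eqP.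
by rewrite eqxx oner_eq0.
Qed.

HB.instance Definition _ := GRing.Zmodule_isComNzRing.Build (fps n R)
  fps_mulA fps_mulC fps_mul1 fps_mulDl fps_oner_neq0.

Definition fps_unit : {pred fps n R} := fun f => `[< exists g, g * f = 1 >].

Definition fps_inv f : fps n R :=
  if pselect (exists g, g * f = 1) is left e then sval (cid e) else f.

Fact fps_mulVf : {in fps_unit, left_inverse 1 fps_inv *%R}.
Proof.
move=> f /asboolP fU; rewrite /fps_inv; case: pselect => // e.
by case: cid.
Qed.

Fact fps_unitP f g : g * f = 1 -> fps_unit f.
Proof. by move=> gf1; apply/asboolP; exists g. Qed.

Fact fps_inv_out : {in [predC fps_unit], fps_inv =1 id}.
Proof. by move=> f /asboolPn nU; rewrite /fps_inv; case: pselect. Qed.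

HB.instance Definition _ := GRing.ComNzRing_hasMulInverse.Build (fps n R)
  fps_mulVf fps_unitP fps_inv_out.

(* Infinite sums of power series: every monomial receives a contribution from
   finitely many members of the family, and coefficients are added. *)
Definition fps_summable (T : choiceType) (A : set T) (F : T -> fps n R) : Prop :=
  forall m, finite_set [set t | A t /\ fps_coef (F t) m <> 0]%classic.

Definition fps_sum (T : choiceType) (A : set T) (F : T -> fps n R) : fps n R :=
  FPS (fun m => \sum_(t \in A) fps_coef (F t) m).

End FPSRing.

(* Coordinates in Z_+ = {1, 2, ...} are all shifted down by one, so that points
   of Z_+^k are [k.-tuple nat] and [n] = {1, ..., n} becomes {0, ..., n - 1}. *)

Definition addE k (l : 'I_k) (u : k.-tuple nat) : k.-tuple nat :=
  [tuple (tnth u j + (j == l))%N | j < k].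

Definition weakly_decreasing k (f : k.-tuple nat -> nat) : Prop :=
  forall (i : k.-tuple nat) (l : 'I_k), (f (addE l i) <= f i)%N.

Record hpartition (k : nat) := HPartition {
  part_fun :> {fsfun k.-tuple nat -> nat with 0%N};
  _ : `[< weakly_decreasing part_fun >] }.

HB.instance Definition _ k := [isSub for @part_fun k].
HB.instance Definition _ k := [Choice of hpartition k by <:].

Definition hdiagram k (p : hpartition k) : {fset k.+1.-tuple nat} :=
  [fset rcons_tuple i h | i in finsupp p, h in iota 0 (p i)].

Definition hshape k (p : hpartition k) : {fset k.-tuple nat} := finsupp p.

Definition hshape1 k (p : hpartition k) : {fset k.-tuple nat} :=
  [fset behead_tuple u | u in hdiagram p].

Definition hcorners k (p : hpartition k) : {fset k.+1.-tuple nat} :=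
  [fset u in hdiagram p |
    [forall l : 'I_k, addE (widen_ord (leqnSn k) l) u \notin hdiagram p]].

(* The diagram of [p] lies in [n_1] x ... x [n_k] x Z_+. *)
Definition hdiagram_in_box k (n : 'I_k -> nat) (p : hpartition k) : Prop :=
  forall u, u \in hdiagram p ->
  forall l : 'I_k, (tnth u (widen_ord (leqnSn k) l) < n l)%N.

Lemma mem_hdiagram k (p : hpartition k) (i : k.-tuple nat) (h : nat) :
  (rcons_tuple i h \in hdiagram p) = (h < p i)%N.
Proof.
apply/imfset2P/idP => [[/= j _ [h']]|hp].
  rewrite mem_iota add0n /= => h'p /(congr1 val) /= /eqP.
  by rewrite eqseq_rcons => /andP[/eqP/val_inj -> /eqP ->].
exists i; first by rewrite mem_finsupp -lt0n (leq_ltn_trans _ hp).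
by exists h => //; rewrite mem_iota.
Qed.

Lemma hdiagram_inj k : injective (@hdiagram k).
Proof.
move=> p q pq; apply: val_inj; apply/fsfunP => i.
apply/eqP; rewrite eqn_leq; apply/andP; split; rewrite leqNgt; apply/negP.
  by rewrite -(mem_hdiagram p) pq mem_hdiagram ltnn.
by rewrite -(mem_hdiagram q) -pq mem_hdiagram ltnn.
Qed.

Section Grothendieck.
Variable R : comNzRingType.

Definition vars d (n : 'I_d -> nat) : finType := {k : 'I_d & 'I_(n k)}.

(* [xvar n k j] is the variable x^(k)_j, extended by 0 to j outside [n_k]. *)
Definition xvar d (n : 'I_d -> nat) (k : 'I_d) (j : nat) :
    {mpoly R[#|vars n|]} :=
  if (insub j : option 'I_(n k)) is Some j' then
    'X_(enum_rank (Tagged (fun l => 'I_(n l)) j' : vars n))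
  else 0.

Definition gindex d (n : 'I_d.+1 -> nat) (rho : hpartition d) :
    set (hpartition d.+1) :=
  [set pi | hdiagram_in_box n pi /\ hshape1 pi = hdiagram rho]%classic.

Definition grothendieck d (n : 'I_d.+1 -> nat) (rho : hpartition d) :
    {mpoly R[#|vars n|]} :=
  \sum_(pi \in gindex n rho)
    \prod_(u <- hcorners pi)
      \prod_(k < d.+1) xvar n k (tnth u (widen_ord (leqnSn d.+1) k)).

(* So the convention giving 0 to sums of infinite support is never used in
   [grothendieck]. *)
Lemma finite_gindex d (n : 'I_d.+1 -> nat) (rho : hpartition d) :
  finite_set (gindex n rho).
Proof.
pose B : {fset d.+2.-tuple nat} :=
  [fset cons_tuple i u | i in iota 0 (n ord0), u in hdiagram rho].
apply: (@sub_finite_set _ _ (@hdiagram d.+1 @^-1` [set` fpowerset B])%classic).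
  move=> pi [box sh1]; rewrite /= fpowersetE; apply/fsubsetP => u uD.
  apply/imfset2P; exists (thead u).
    rewrite mem_iota /= add0n.
    have -> : thead u = tnth u (widen_ord (leqnSn d.+1) ord0).
      by rewrite /thead; congr tnth; apply: val_inj.
    exact: box.
  exists (behead_tuple u); last by rewrite {1}(tuple_eta u); apply: val_inj.
  by rewrite -sh1; apply/imfsetP; exists u.
apply: finite_preimage => [p q _ _|]; first exact: hdiagram_inj.
exact: finite_fset.
Qed.

End Grothendieck.

Definition prism k (n1 : nat) (D : {fset k.-tuple nat}) :
    {fset k.+1.-tuple nat} :=
  [fset cons_tuple i u | i in iota 0 n1, u in D].

(* Main.v *)
(* Taking the union over [rho], the left-hand side is a sum over all partitions
   [pi] whose shape lies in the down-closed set [B = n_1 x D(eta)].  Above a point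
   [i] the corners of [pi] are the heights from [max_l pi (i + e_l)] up to [pi i],
   so [pi] has weight [\prod_(i in B) x_i ^ a_i] with
   [a_i = pi i - max_l pi (i + e_l)].  The last-passage recursion
   [pi i = a_i + max_l pi (i + e_l)] recovers [pi] from an arbitrary
   [a : B -> nat], and summing over all [a] gives the product of the geometric
   series [1 / (1 - x_i)]. *)

From HB Require Import structures.
Require Import Defs.
From mathcomp Require Import all_boot all_order all_algebra.
From mathcomp Require Import finmap.
From mathcomp Require Import boolp classical_sets functions cardinality fsbigop.
From mathcomp Require Import mpoly.

Set Implicit Arguments.
Unset Strict Implicit.
Unset Printing Implicit Defensive.

Import GRing.Theory.
Local Open Scope classical_set_scope.
Local Open Scope ring_scope.

Section FinitelySupportedBigop.
Variables (R : Type) (idx : R) (op : Monoid.com_law idx).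

Lemma partition_fsbig (T U : choiceType) (A : set T) (B : set U) (h : T -> U)
    (F : T -> R) :
    finite_set (A `&` F @^-1` [set~ idx]) -> h @` A `<=` B ->
  \big[op/idx]_(t \in A) F t =
  \big[op/idx]_(u \in B) \big[op/idx]_(t \in A `&` h @^-1` [set u]) F t.
Proof.
set S := A `&` _ => finS hAB.
have SE t : (t \in fset_set S) = `[< S t >] by rewrite in_fset_set.
have fiberE u : \big[op/idx]_(t \in A `&` h @^-1` [set u]) F t =
    \big[op/idx]_(t <- fset_set S | h t == u) F t.
  rewrite big_fset_condE [RHS]fsbig_seq ?fset_uniq //; symmetry; apply: fsbig_widen.
    by move=> t; rewrite /= !inE SE /= => /andP[/asboolP[At _] /eqP].
  move=> t [[At htu]]; rewrite /= !inE SE /= htu eqxx andbT => nS.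
  by apply: contrapT => Ft; apply: nS; apply/asboolP.
rewrite fsbig_supp fsbig_finite // (partition_big_imfset _ h) [LHS]fsbig_seq ?fset_uniq //.
under [RHS]eq_fsbigr do rewrite fiberE.
apply: fsbig_widen => [_ /imfsetP[t /= + ->]|u [_ /= /negP nu]].
  by rewrite SE => /asboolP[At _]; apply: hAB; exists t.
rewrite big_seq_cond big1 // => t /andP[tS /eqP htu].
by case/negP: nu; rewrite -htu; apply: in_imfset.
Qed.

Lemma fsbig_setT_finType (T : finType) (F : T -> R) :
  \big[op/idx]_(t \in [set: T]) F t = \big[op/idx]_t F t.
Proof.
rewrite (fsbigE (index_enum T)) ?index_enum_uniq //.
  by apply: eq_bigl => t; rewrite in_setT.
by move=> t _; rewrite mem_index_enum.
Qed.

End FinitelySupportedBigop.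

Definition ffuns_below (I : finType) N : set {ffun I -> nat} :=
  [set a | forall i, (a i < N)%N].
Arguments ffuns_below : clear implicits.

Definition ffun_nat_of_ord (I : finType) N (a : {ffun I -> 'I_N}) : {ffun I -> nat} :=
  [ffun i => val (a i)].

Lemma ffun_nat_of_ord_bij (I : finType) N :
  set_bij setT (ffuns_below I N) (@ffun_nat_of_ord I N).
Proof.
split=> [a _ i|a b _ _ ab|a aN]; first by rewrite ffunE ltn_ord.
  by apply/ffunP => i; move/ffunP/(_ i): ab; rewrite !ffunE => /val_inj.
by exists [ffun i => Ordinal (aN i)] => //; apply/ffunP => i; rewrite !ffunE.
Qed.

Section PowerSeries.
Variables (n : nat) (R : comNzRingType).
Implicit Types (f g : fps n R) (N M : nat).

Lemma fps_coef_sum (I : Type) (s : seq I) (F : I -> fps n R) m :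
  fps_coef (\sum_(i <- s) F i) m = \sum_(i <- s) fps_coef (F i) m.
Proof. exact: (big_morph (fun f => fps_coef f m)). Qed.

Definition fps_eq_upto N f g : Prop :=
  forall m, (mdeg m < N)%N -> fps_coef f m = fps_coef g m.

Lemma fps_eq_uptoM N f f' g g' :
  fps_eq_upto N f f' -> fps_eq_upto N g g' -> fps_eq_upto N (f * g) (f' * g').
Proof.
move=> ff' gg' m mN; apply: eq_bigr => k _.
by rewrite ff' ?gg' //; apply: leq_trans mN; apply: bmdeg.
Qed.

Lemma fps_eq_upto_prod N (I : Type) (s : seq I) (F G : I -> fps n R) :
    (forall i, fps_eq_upto N (F i) (G i)) ->
  fps_eq_upto N (\prod_(i <- s) F i) (\prod_(i <- s) G i).
Proof.
by move=> FG; elim/big_rec2: _ => // i f g _; apply: fps_eq_uptoM.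
Qed.

Lemma fps_eq_upto0M N M f g :
  fps_eq_upto N f 0 -> fps_eq_upto M g 0 -> fps_eq_upto (N + M) (f * g) 0.
Proof.
move=> f0 g0 m mNM; apply: big1 => k /eqP mk.
have [k1N|Nk1] := ltnP (mdeg k.1) N; first by rewrite f0 // mul0r.
rewrite g0 ?mulr0 // -(ltn_add2l N); apply: leq_ltn_trans mNM.
by rewrite [X in (_ <= X)%N](congr1 (@mdeg n) mk) mdegD leq_add2r.
Qed.

Lemma fps_eq_upto0_prod (I : Type) (s : seq I) (F : I -> fps n R) (N : I -> nat) :
    (forall i, fps_eq_upto (N i) (F i) 0) ->
  fps_eq_upto (\sum_(i <- s) N i) (\prod_(i <- s) F i) 0.
Proof.
by move=> F0; elim/big_rec2: _ => // i f N' _; apply: fps_eq_upto0M.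
Qed.

Lemma fps_eq_upto0X N f : fps_coef f 0%MM = 0 -> fps_eq_upto N (f ^+ N) 0.
Proof.
move=> f_const0; have f_upto1 : fps_eq_upto 1 f 0.
  by move=> m; rewrite ltnS leqn0 mdeg_eq0 => /eqP ->.
have := fps_eq_upto0_prod (s := index_enum 'I_N) (fun=> f_upto1).
by rewrite sum_nat_const prodr_const card_ord muln1.
Qed.

Lemma eq_fps_sum (T : choiceType) (A : set T) (F G : T -> fps n R) :
  (forall t, A t -> F t = G t) -> fps_sum A F = fps_sum A G.
Proof.
move=> FG; apply: fpsP => m; apply: eq_fsbigr => t.
by rewrite inE => At; rewrite FG.
Qed.

Lemma eq_fps_summable (T : choiceType) (A : set T) (F G : T -> fps n R) :
  (forall t, A t -> F t = G t) -> fps_summable A G -> fps_summable A F.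
Proof.
move=> FG Gfin m; apply: sub_finite_set (Gfin m) => t [At Ft].
by split=> //; rewrite -FG.
Qed.

Section Reindex.
Variables (S T : choiceType) (A : set S) (B : set T) (h : S -> T).
Hypothesis h_bij : set_bij A B h.

Lemma fps_sum_reindex (F : T -> fps n R) : fps_sum B F = fps_sum A (F \o h).
Proof. by apply: fpsP => m; apply: reindex_fsbig h_bij. Qed.

Lemma fps_summable_reindex (F : T -> fps n R) :
  fps_summable A (F \o h) -> fps_summable B F.
Proof.
case: h_bij => _ _ hsurj Fh m; apply: sub_finite_set (finite_image h (Fh m)).
by move=> t [Bt Ft]; have [s As hs] := hsurj t Bt; exists s; rewrite //= hs.
Qed.

End Reindex.

Section Fibers.
Variables (S T : choiceType) (A : set S) (B : set T) (h : S -> T) (F : S -> fps n R).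
Hypotheses (F_summable : fps_summable A F) (h_im : h @` A `<=` B).

Let fiber_sum t : fps n R := fps_sum (A `&` h @^-1` [set t]) F.

Lemma fps_sum_fibers : fps_sum B fiber_sum = fps_sum A F.
Proof. by apply: fpsP => m; rewrite [RHS](partition_fsbig _ (F_summable m) h_im). Qed.

Lemma fps_summable_fibers : fps_summable B fiber_sum.
Proof.
move=> m; apply: sub_finite_set (finite_image h (F_summable m)) => t [Bt Ft].
apply: contrapT => nt; apply: Ft; apply: fsbig1 => s [As hs].
by apply: contrapT => Fs; apply: nt; exists s.
Qed.

End Fibers.

Lemma fps_eq_upto_sum N (F : nat -> fps n R) :
    (forall j, fps_eq_upto j (F j) 0) ->
  fps_eq_upto N (fps_sum setT F) (\sum_(j < N) F j).
Proof.
move=> F_order m mN; rewrite fps_coef_sum (fsbig_ord _ N (fun j => fps_coef (F j) m)).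
symmetry; apply: fsbig_widen => // j [_ /negP].
by rewrite -leqNgt => Nj; apply/F_order/(leq_trans mN).
Qed.

Section ProductOfSums.
Variables (I : finType) (F : I -> nat -> fps n R).
Hypothesis F_order : forall i j, fps_eq_upto j (F i j) 0.

Let term (a : {ffun I -> nat}) : fps n R := \prod_i F i (a i).

Let term_neq0_le m a : fps_coef (term a) m <> 0 -> forall i, (a i < (mdeg m).+1)%N.
Proof.
move=> Fm i; rewrite ltnNge; apply/negP => mi; apply: Fm.
apply: (fps_eq_upto0_prod _ (N := a)) => //.
by rewrite (bigD1 i) //= (leq_trans mi) ?leq_addr.
Qed.

Lemma fps_summable_prod : fps_summable setT term.
Proof.
move=> m; apply: (@sub_finite_set _ _ (ffuns_below I (mdeg m).+1)).
  by move=> a [_ /term_neq0_le].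
have [_ _ surj] := ffun_nat_of_ord_bij I (mdeg m).+1.
by apply: (sub_finite_set surj); apply/finite_image/finite_finset.
Qed.

Lemma fps_prod_sum : \prod_i fps_sum setT (F i) = fps_sum setT term.
Proof.
apply: fpsP => m; have mN := ltnSn (mdeg m).
transitivity (fps_coef (\prod_i \sum_(j < (mdeg m).+1) F i j) m).
  by apply: (fps_eq_upto_prod _ _ mN) => i; apply: fps_eq_upto_sum.
rewrite bigA_distr_bigA fps_coef_sum -fsbig_setT_finType.
rewrite /= -(@fsbig_widen _ _ _ _ (ffuns_below I (mdeg m).+1)) //; last first.
  by move=> a [_ /= aN]; apply: contrapT => /term_neq0_le.
rewrite (reindex_fsbig _ _ _ _ (ffun_nat_of_ord_bij I (mdeg m).+1)).
by apply: eq_fsbigr => a _; congr (fps_coef _ m); apply: eq_bigr => i _; rewrite ffunE.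
Qed.

End ProductOfSums.

Lemma fps_inv_1sub f : fps_coef f 0%MM = 0 ->
  (1 - f)^-1 = fps_sum setT (fun j => f ^+ j).
Proof.
move=> f_const0; apply: mulr1_eq; apply: fpsP => m.
have f_powers j : fps_eq_upto j (f ^+ j) 0 by apply: fps_eq_upto0X.
rewrite (fps_eq_uptoM (f' := 1 - f) _ (fps_eq_upto_sum f_powers) (ltnSn (mdeg m))) //.
rewrite -opprB mulNr -subrX1 opprB.
by rewrite [LHS](congr1 (fun c => _ - c) (f_powers _ m (ltnSn _))) subr0.
Qed.

Lemma fps_summable_prodX (I : finType) (F : I -> fps n R) :
    (forall i, fps_coef (F i) 0%MM = 0) ->
  fps_summable setT (fun a : {ffun I -> nat} => \prod_i F i ^+ a i).
Proof.
move=> F_const0; apply: (fps_summable_prod (F := fun i j => F i ^+ j)) => i j.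
exact: fps_eq_upto0X.
Qed.

Lemma fps_prod_inv_1sub (I : finType) (F : I -> fps n R) :
    (forall i, fps_coef (F i) 0%MM = 0) ->
  \prod_i (1 - F i)^-1 = fps_sum setT (fun a : {ffun I -> nat} => \prod_i F i ^+ a i).
Proof.
move=> F_const0; rewrite -(fps_prod_sum (F := fun i j => F i ^+ j)).
  by apply: eq_bigr => i _; apply: fps_inv_1sub.
by move=> i j; apply: fps_eq_upto0X.
Qed.

Fact fps_of_mpoly_is_zmod_morphism : zmod_morphism (@fps_of_mpoly n R).
Proof. by move=> p q; apply: fpsP => m; rewrite /= mcoeffB. Qed.

Fact fps_of_mpoly_is_monoid_morphism : monoid_morphism (@fps_of_mpoly n R).
Proof. by split=> [|p q]; apply: fpsP => m; rewrite /= ?mcoeff1 ?mcoeffM. Qed.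

HB.instance Definition _ :=
  GRing.isZmodMorphism.Build _ _ (@fps_of_mpoly n R) fps_of_mpoly_is_zmod_morphism.
HB.instance Definition _ :=
  GRing.isMonoidMorphism.Build _ _ (@fps_of_mpoly n R) fps_of_mpoly_is_monoid_morphism.

Lemma fps_of_mpoly_fsbig (T : choiceType) (A : set T) (F : T -> {mpoly R[n]}) :
    finite_set A ->
  fps_of_mpoly (\sum_(t \in A) F t) = fps_sum A (fun t => fps_of_mpoly (F t)).
Proof.
move=> Afin; apply: fpsP => m.
by rewrite /= !fsbig_finite // raddf_sum.
Qed.

End PowerSeries.

Section Tuples.
Variables (T : Type) (k : nat).
Implicit Types (i : k.-tuple T) (h : T).

Variant tuple_rcons_spec : k.+1.-tuple T -> Type :=
  TupleRconsSpec i h : tuple_rcons_spec (rcons_tuple i h).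

Lemma tuple_rconsP (u : k.+1.-tuple T) : tuple_rcons_spec u.
Proof.
case: u; case/lastP=> [//|s h] size_sh.
have size_s : size s == k by move: size_sh; rewrite size_rcons eqSS.
have -> : Tuple size_sh = rcons_tuple (Tuple size_s) h by apply: val_inj.
by [].
Qed.

Lemma rcons_tuple_inj i j g h : rcons_tuple i g = rcons_tuple j h -> i = j /\ g = h.
Proof. by move/(congr1 val) => /= /rcons_inj[/val_inj -> ->]. Qed.

Lemma cons_tuple_inj i j g h : cons_tuple g i = cons_tuple h j -> g = h /\ i = j.
Proof. by move/(congr1 val) => /= -[-> /val_inj ->]. Qed.

Lemma behead_cons_tuple i h : behead_tuple (cons_tuple h i) = i.
Proof. exact: val_inj. Qed.

Lemma lift_ord_max (l : 'I_k) : lift ord_max l = widen_ord (leqnSn k) l.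
Proof. exact/val_inj/lift_max. Qed.

Lemma tnth_rcons_widen i h (l : 'I_k) :
  tnth (rcons_tuple i h) (widen_ord (leqnSn k) l) = tnth i l.
Proof. by rewrite !(tnth_nth h) /= nth_rcons size_tuple ltn_ord. Qed.

Lemma tnth_rcons_max i h : tnth (rcons_tuple i h) ord_max = h.
Proof. by rewrite (tnth_nth h) /= nth_rcons size_tuple ltnn eqxx. Qed.

End Tuples.

Section UnitSteps.
Variable k : nat.
Implicit Types (i : k.-tuple nat) (l : 'I_k) (h : nat).

Lemma addE_rcons_widen i h l :
  addE (widen_ord (leqnSn k) l) (rcons_tuple i h) = rcons_tuple (addE l i) h.
Proof.
apply: eq_from_tnth => j; rewrite tnth_mktuple.
case: (unliftP ord_max j) => [j'|] ->; rewrite ?lift_ord_max.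
  by rewrite !tnth_rcons_widen tnth_mktuple -val_eqE.
by rewrite !tnth_rcons_max -val_eqE /= gtn_eqF ?ltn_ord ?addn0.
Qed.

Lemma addE_rcons_max i h : addE ord_max (rcons_tuple i h) = rcons_tuple i h.+1.
Proof.
apply: eq_from_tnth => j; rewrite tnth_mktuple.
case: (unliftP ord_max j) => [j'|] ->; rewrite ?lift_ord_max.
  by rewrite !tnth_rcons_widen -val_eqE /= ltn_eqF ?ltn_ord ?addn0.
by rewrite !tnth_rcons_max eqxx addn1.
Qed.

Lemma addE_cons0 i h : addE ord0 (cons_tuple h i) = cons_tuple h.+1 i.
Proof.
apply: eq_from_tnth => j; rewrite tnth_mktuple.
by case: (unliftP ord0 j) => [j'|] ->; rewrite ?tnthS ?tnth0 ?addn0 ?addn1.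
Qed.

Lemma addE_cons_lift i h l :
  addE (lift ord0 l) (cons_tuple h i) = cons_tuple h (addE l i).
Proof.
apply: eq_from_tnth => j; rewrite tnth_mktuple.
case: (unliftP ord0 j) => [j'|] ->; last by rewrite !tnth0 addn0.
by rewrite !tnthS tnth_mktuple (inj_eq lift_inj).
Qed.

Definition coord_sum i : nat := \sum_j tnth i j.

Lemma coord_sum_addE i l : coord_sum (addE l i) = (coord_sum i).+1.
Proof.
rewrite /coord_sum; under eq_bigr do rewrite tnth_mktuple.
by rewrite big_split /= -big_mkcond big_pred1_eq addn1.
Qed.

Definition coord_bound (B : {fset k.-tuple nat}) : nat :=
  \max_(i <- B) (coord_sum i).+1.

Lemma coord_sum_lt_bound (B : {fset k.-tuple nat}) i :
  i \in B -> (coord_sum i < coord_bound B)%N.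
Proof. by move=> iB; apply: (leq_bigmax_seq (F := fun i => (coord_sum i).+1)). Qed.

Lemma addE_ind (B : {fset k.-tuple nat}) (P : k.-tuple nat -> Prop) :
  (forall i, (i \in B -> forall l, P (addE l i)) -> P i) -> forall i, P i.
Proof.
move=> Pstep i; have := leq_addl (coord_sum i) (coord_bound B).
elim: {2}(coord_bound B) i => [|m IHm] i bound_le; apply: Pstep => iB l.
  by move: bound_le; rewrite addn0 leqNgt coord_sum_lt_bound.
by apply: IHm; rewrite coord_sum_addE addSnnS.
Qed.

End UnitSteps.

Definition down_closed k (B : {fset k.-tuple nat}) : Prop :=
  forall i l, addE l i \in B -> i \in B.

Definition hpartitions_in k (B : {fset k.-tuple nat}) : set (hpartition k) :=
  [set p | (hshape p `<=` B)%fset].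

Section HPartition.
Variable k : nat.
Implicit Types (p : hpartition k) (i : k.-tuple nat) (B D : {fset k.-tuple nat}).

Lemma hpartition_decr p : weakly_decreasing p.
Proof. by case: p => p /= /asboolP. Qed.

Lemma mem_hshape p i : (i \in hshape p) = (0 < p i)%N.
Proof. by rewrite mem_finsupp lt0n. Qed.

Lemma hpartition_eq0 B p i : hpartitions_in B p -> i \notin B -> p i = 0%N.
Proof.
by move=> /fsubsetP pB; apply: contraNeq; rewrite -lt0n -mem_hshape; apply: pB.
Qed.

Lemma hdiagram_down_closed p : down_closed (hdiagram p).
Proof.
move=> u l; case/tuple_rconsP: u => i h.
case: (unliftP ord_max l) => [l'|] ->; rewrite ?lift_ord_max.
  rewrite addE_rcons_widen !mem_hdiagram => /leq_trans; apply.
  exact: hpartition_decr.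
by rewrite addE_rcons_max !mem_hdiagram; apply: ltnW.
Qed.

Lemma hdiagram_in_boxP (n : 'I_k -> nat) p :
  hdiagram_in_box n p <-> forall i, i \in hshape p -> forall l, (tnth i l < n l)%N.
Proof.
split=> box => [i|u]; last case/tuple_rconsP: u => i h.
  rewrite mem_hshape -mem_hdiagram => /box i_lt l.
  by have := i_lt l; rewrite tnth_rcons_widen.
rewrite mem_hdiagram => /(leq_ltn_trans (leq0n h)); rewrite -mem_hshape => /box i_lt l.
by rewrite tnth_rcons_widen.
Qed.

Lemma mem_prism n1 D h i : (cons_tuple h i \in prism n1 D) = (h < n1)%N && (i \in D).
Proof.
apply/imfset2P/andP => /= [[h' h'n [i' i'D hi]]|[hn iD]].
  by have [-> ->] := cons_tuple_inj hi; move: h'n; rewrite mem_iota.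
by exists h; [rewrite mem_iota | exists i].
Qed.

Lemma prism_down_closed n1 D : down_closed D -> down_closed (prism n1 D).
Proof.
move=> D_down u l; case/tupleP: u => h i.
case: (unliftP ord0 l) => [l'|] ->.
  by rewrite addE_cons_lift !mem_prism => /andP[-> /D_down].
by rewrite addE_cons0 !mem_prism => /andP[/ltnW -> ->].
Qed.

End HPartition.

Section Jumps.
Variable k : nat.
Implicit Types (p : hpartition k) (i : k.-tuple nat).

Definition next_max (f : k.-tuple nat -> nat) i : nat := \max_(l < k) f (addE l i).

Definition jump (f : k.-tuple nat -> nat) i : nat := f i - next_max f i.

Lemma next_max_le p i : (next_max p i <= p i)%N.
Proof. by apply/bigmax_leqP => l _; apply: hpartition_decr. Qed.

Lemma mem_hcorners p i h :
  (rcons_tuple i h \in hcorners p) = (next_max p i <= h < p i)%N.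
Proof.
rewrite !inE /= mem_hdiagram andbC; congr (_ && _).
apply/forallP/bigmax_leqP => [corner l _|le_h l].
  by have := corner l; rewrite addE_rcons_widen mem_hdiagram -leqNgt.
by rewrite addE_rcons_widen mem_hdiagram -leqNgt le_h.
Qed.

Lemma perm_hcorners (B : {fset k.-tuple nat}) p : hpartitions_in B p ->
  perm_eq (hcorners p)
    [seq rcons_tuple i h | i <- B, h <- index_iota (next_max p i) (p i)].
Proof.
move=> pB; apply: uniq_perm; first exact: fset_uniq.
  apply: allpairs_uniq_dep => [|i _|]; [exact: fset_uniq|exact: iota_uniq|].
  by move=> [i h] [j g] _ _ /= ih_jg; have [-> ->] := rcons_tuple_inj ih_jg.
move=> u; case/tuple_rconsP: u => i h; rewrite mem_hcorners.
apply/idP/allpairsPdep => [h_range|[j [g [_]]]].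
  exists i, h; rewrite mem_index_iota; split=> //.
  by apply: contraLR h_range => /(hpartition_eq0 pB) ->; rewrite ltn0 andbF.
by rewrite mem_index_iota => g_range ih_jg; have [-> ->] := rcons_tuple_inj ih_jg.
Qed.

Lemma prod_hcorners (S : comPzSemiRingType) (B : {fset k.-tuple nat}) p
    (F : k.+1.-tuple nat -> S) (G : k.-tuple nat -> S) :
    hpartitions_in B p -> (forall i h, F (rcons_tuple i h) = G i) ->
  \prod_(u <- hcorners p) F u = \prod_(i <- B) G i ^+ jump p i.
Proof.
move=> pB FG; rewrite (perm_big _ (perm_hcorners pB)) big_allpairs_dep /=.
by apply: eq_bigr => i _; under eq_bigr do rewrite FG; rewrite prodr_const_nat.
Qed.

End Jumps.

Section LastPassage.
Variables (k : nat) (B : {fset k.-tuple nat}).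
Implicit Types (a : {ffun B -> nat}) (f g : k.-tuple nat -> nat) (i : k.-tuple nat).

Definition passage_step a f i : nat :=
  if (insub i : option B) is Some b then a b + next_max f i else 0.

Lemma eq_passage_step a f g i :
  (i \in B -> forall l, f (addE l i) = g (addE l i)) ->
  passage_step a f i = passage_step a g i.
Proof.
rewrite /passage_step; case: insubP => // b iB _ fg; congr (_ + _)%N.
by apply: eq_bigr => l _; apply: fg.
Qed.

(* [passage_step] reads only points of larger coordinate sum, so the iterates
   are stationary once their number exceeds every coordinate sum on [B]. *)
Definition last_passage a : k.-tuple nat -> nat :=
  iter (coord_bound B) (passage_step a) (fun=> 0%N).

Lemma iter_passage_step a m i : (coord_bound B <= coord_sum i + m)%N ->
  iter m.+1 (passage_step a) (fun=> 0%N) i = iter m (passage_step a) (fun=> 0%N) i.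
Proof.
elim: m i => [|m IHm] i bound_le.
  rewrite /= /passage_step insubN //; apply: contraL bound_le => iB.
  by rewrite addn0 -ltnNge coord_sum_lt_bound.
apply: (@eq_passage_step a (iter m.+1 _ _) (iter m _ _)) => _ l.
by apply: IHm; rewrite coord_sum_addE addSnnS.
Qed.

Lemma last_passage_fix a : last_passage a =1 passage_step a (last_passage a).
Proof. by move=> i; symmetry; apply: iter_passage_step; apply: leq_addl. Qed.

Lemma last_passage_out a i : i \notin B -> last_passage a i = 0%N.
Proof. by move=> iB; rewrite last_passage_fix /passage_step insubN. Qed.

Lemma last_passageE a (b : B) :
  last_passage a (val b) = (a b + next_max (last_passage a) (val b))%N.
Proof. by rewrite last_passage_fix /passage_step valK. Qed.

Lemma passage_step_fix_uniq a f g :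
  f =1 passage_step a f -> g =1 passage_step a g -> f =1 g.
Proof.
move=> f_fix g_fix; apply: (addE_ind (B := B)) => i IHi.
by rewrite f_fix g_fix; apply: eq_passage_step.
Qed.

Lemma passage_step_jump (p : hpartition k) : hpartitions_in B p ->
  p =1 passage_step [ffun b => jump p (val b)] p.
Proof.
move=> pB i; rewrite /passage_step; case: insubP => [b _ <-|/(hpartition_eq0 pB) //].
by rewrite ffunE subnK ?next_max_le.
Qed.

Hypothesis B_down : down_closed B.

Definition last_passage_fsfun a : {fsfun k.-tuple nat -> nat with 0%N} :=
  [fsfun i in B => last_passage a i].

Lemma last_passage_fsfunE a : last_passage_fsfun a =1 last_passage a.
Proof.
by move=> i; rewrite fsfun_fun; case: ifPn => // /(last_passage_out a) ->.
Qed.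

Fact last_passage_decr a : `[< weakly_decreasing (last_passage_fsfun a) >].
Proof.
apply/asboolP => i l; rewrite !last_passage_fsfunE.
have [lB|lB] := boolP (addE l i \in B); last by rewrite (last_passage_out a lB).
rewrite [leqRHS](last_passageE a [` B_down lB]%fset).
apply: leq_trans (leq_addl _ _).
exact: (leq_bigmax (F := fun l => last_passage a (addE l i))).
Qed.

Definition last_passage_partition a : hpartition k :=
  HPartition (last_passage_decr a).

Lemma last_passage_partition_in a : hpartitions_in B (last_passage_partition a).
Proof.
apply/fsubsetP => i; rewrite mem_hshape; apply: contraTT => iB.
by rewrite /= last_passage_fsfunE last_passage_out.
Qed.

Lemma jump_last_passage a (b : B) : jump (last_passage_partition a) (val b) = a b.
Proof.
rewrite /jump /next_max last_passage_fsfunE.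
under eq_bigr do rewrite last_passage_fsfunE.
by rewrite last_passageE addnK.
Qed.

Lemma last_passage_partition_bij :
  set_bij setT (hpartitions_in B) last_passage_partition.
Proof.
split=> [a _|a b _ _ ab|p pB]; first exact: last_passage_partition_in.
  by apply/ffunP => i; rewrite -!jump_last_passage ab.
exists [ffun b => jump p (val b)] => //; apply/val_inj/fsfunP => i /=.
rewrite last_passage_fsfunE; apply: passage_step_fix_uniq i.
  exact: last_passage_fix.
exact: passage_step_jump.
Qed.

End LastPassage.

Section FirstSlice.
Variable k : nat.
Implicit Types (p : hpartition k.+1) (rho : hpartition k) (j : k.-tuple nat).

Definition first_slice_fsfun p : {fsfun k.-tuple nat -> nat with 0%N} :=
  [fsfun j in [fset behead_tuple i | i in finsupp p]%fset => p (cons_tuple 0%N j)].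

Lemma first_slice_fsfunE p j : first_slice_fsfun p j = p (cons_tuple 0%N j).
Proof.
rewrite fsfun_fun; case: ifPn => // /imfsetP j_out; apply/esym/eqP.
apply/negPn/negP => pj; apply: j_out; exists (cons_tuple 0%N j).
  by rewrite /= mem_finsupp.
by rewrite behead_cons_tuple.
Qed.

Fact first_slice_decr p : `[< weakly_decreasing (first_slice_fsfun p) >].
Proof.
apply/asboolP => j l; rewrite !first_slice_fsfunE -addE_cons_lift.
exact: hpartition_decr.
Qed.

Definition first_slice p : hpartition k := HPartition (first_slice_decr p).

Lemma first_sliceE p j : first_slice p j = p (cons_tuple 0%N j).
Proof. exact: first_slice_fsfunE. Qed.

Lemma le_first_slice p h j : (p (cons_tuple h j) <= first_slice p j)%N.
Proof.
rewrite first_sliceE; elim: h => // h; apply: leq_trans.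
by rewrite -addE_cons0 hpartition_decr.
Qed.

Lemma mem_hdiagram_cons_rcons p h j g :
  (cons_tuple h (rcons_tuple j g) \in hdiagram p) = (g < p (cons_tuple h j))%N.
Proof.
have -> : cons_tuple h (rcons_tuple j g) = rcons_tuple (cons_tuple h j) g.
  exact: val_inj.
by rewrite mem_hdiagram.
Qed.

Lemma hshape1_first_slice p : hshape1 p = hdiagram (first_slice p).
Proof.
apply/fsetP => v; apply/imfsetP/idP => [[u /= + ->]|].
  case/tupleP: u => h i; rewrite behead_cons_tuple.
  case/tuple_rconsP: i => j g; rewrite mem_hdiagram_cons_rcons mem_hdiagram.
  by move/leq_trans; apply; apply: le_first_slice.
case/tuple_rconsP: v => j g; rewrite mem_hdiagram first_sliceE => gp.
exists (cons_tuple 0%N (rcons_tuple j g)); last by rewrite behead_cons_tuple.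
by rewrite /= mem_hdiagram_cons_rcons.
Qed.

Lemma gindexE (n : 'I_k.+1 -> nat) rho :
  gindex n rho = [set p | hdiagram_in_box n p] `&` first_slice @^-1` [set rho].
Proof.
rewrite eqEsubset; split=> p /= [p_box slice_p]; split=> //=.
  by apply: hdiagram_inj; rewrite -hshape1_first_slice.
by rewrite hshape1_first_slice slice_p.
Qed.

Section Prism.
Variables (n : 'I_k.+1 -> nat) (D : {fset k.-tuple nat}).
Hypothesis D_in_box : forall u, u \in D -> forall l, (tnth u l < n (lift ord0 l))%N.

Lemma hpartitions_in_prism p : hpartitions_in (prism (n ord0) D) p <->
  hdiagram_in_box n p /\ hpartitions_in D (first_slice p).
Proof.
split=> [/fsubsetP pB|[/hdiagram_in_boxP p_box /fsubsetP pD]].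
  split; last first.
    apply/fsubsetP => j; rewrite mem_hshape first_sliceE -mem_hshape => /pB.
    by rewrite mem_prism => /andP[].
  apply/hdiagram_in_boxP => i /pB; case/tupleP: i => h j.
  rewrite mem_prism => /andP[hn jD] l.
  by case: (unliftP ord0 l) => [l'|] ->; rewrite ?tnthS ?tnth0 ?D_in_box.
apply/fsubsetP => i; case/tupleP: i => h j pi; rewrite mem_prism.
rewrite (p_box _ pi ord0) pD //; move: pi; rewrite !mem_hshape => /leq_trans; apply.
exact: le_first_slice.
Qed.

Lemma gindex_prism rho : hpartitions_in D rho ->
  gindex n rho = hpartitions_in (prism (n ord0) D) `&` first_slice @^-1` [set rho].
Proof.
move=> rhoD; rewrite gindexE eqEsubset.
by split=> p /= [pP pr]; split=> //; move: pP; rewrite hpartitions_in_prism pr // => -[].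
Qed.

Lemma first_slice_prism_sub :
  first_slice @` hpartitions_in (prism (n ord0) D) `<=` hpartitions_in D.
Proof. by move=> _ [p /hpartitions_in_prism[_ pD] <-]. Qed.

End Prism.

End FirstSlice.

Section CornerWeights.
Variables (R : comNzRingType) (d : nat) (n : 'I_d -> nat).

Definition xmonomial (i : d.-tuple nat) : {mpoly R[#|vars n|]} :=
  \prod_(l < d) xvar R n l (tnth i l).

Definition corner_weight (p : hpartition d) : {mpoly R[#|vars n|]} :=
  \prod_(u <- hcorners p) \prod_(l < d) xvar R n l (tnth u (widen_ord (leqnSn d) l)).

Lemma xvar_coef0 (l : 'I_d) j : (xvar R n l j)@_0 = 0.
Proof.
rewrite /xvar; case: insub => [j'|]; last by rewrite mcoeff0.
by rewrite mcoeffX mnm1_eq0.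
Qed.

Lemma xmonomial_coef0 i : (0 < d)%N -> (xmonomial i)@_0 = 0.
Proof.
move=> d_gt0; rewrite /xmonomial (bigD1 (Ordinal d_gt0)) //=.
by rewrite rmorphM /= xvar_coef0 mul0r.
Qed.

Variable B : {fset d.-tuple nat}.
Hypothesis B_down : down_closed B.

Lemma corner_weight_last_passage (a : {ffun B -> nat}) :
  corner_weight (last_passage_partition B_down a) =
  \prod_(b : B) xmonomial (val b) ^+ a b.
Proof.
rewrite /corner_weight (prod_hcorners (B := B) (G := xmonomial)).
- rewrite big_seq_fsetE; apply: eq_bigr => b _ /=.
  by rewrite jump_last_passage.
- exact: last_passage_partition_in.
- by move=> i h; apply: eq_bigr => l _; rewrite tnth_rcons_widen.
Qed.

Hypothesis d_gt0 : (0 < d)%N.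

Let x (b : B) : fps #|vars n| R := fps_of_mpoly (xmonomial (val b)).

Let x_const0 b : fps_coef (x b) 0%MM = 0.
Proof. exact: xmonomial_coef0. Qed.

Let fps_corner_weightE (a : {ffun B -> nat}) :
  fps_of_mpoly (corner_weight (last_passage_partition B_down a)) =
  \prod_b x b ^+ a b.
Proof.
rewrite corner_weight_last_passage rmorph_prod.
by apply: eq_bigr => b _; rewrite rmorphXn.
Qed.

Lemma fps_summable_corner_weight :
  fps_summable (hpartitions_in B) (fun p => fps_of_mpoly (corner_weight p)).
Proof.
apply: (fps_summable_reindex (last_passage_partition_bij B_down)).
apply: (eq_fps_summable (fun a _ => fps_corner_weightE a)).
exact: fps_summable_prodX x_const0.
Qed.

Lemma fps_sum_corner_weight :
  fps_sum (hpartitions_in B) (fun p => fps_of_mpoly (corner_weight p)) =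
  \prod_(i <- B) (1 - fps_of_mpoly (xmonomial i))^-1.
Proof.
rewrite (fps_sum_reindex (last_passage_partition_bij B_down)).
rewrite (eq_fps_sum (fun a _ => fps_corner_weightE a)).
by rewrite big_seq_fsetE -(fps_prod_inv_1sub x_const0).
Qed.

End CornerWeights.

Lemma fps_of_grothendieck (R : comNzRingType) (d : nat) (n : 'I_d.+1 -> nat)
    (D : {fset d.-tuple nat}) (rho : hpartition d) :
    (forall u, u \in D -> forall l, (tnth u l < n (lift ord0 l))%N) ->
    hpartitions_in D rho ->
  fps_of_mpoly (grothendieck R n rho) =
  fps_sum (hpartitions_in (prism (n ord0) D) `&` @first_slice d @^-1` [set rho])
    (fun p => fps_of_mpoly (corner_weight R n p)).
Proof.
move=> D_in_box rhoD; rewrite -gindex_prism // -fps_of_mpoly_fsbig //.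
exact: finite_gindex.
Qed.

Theorem theorem6p4 (R : comNzRingType) (e : nat) (n : 'I_e.+2 -> nat)
    (n_gt0 : forall k, (0 < n k)%N)
    (eta : hpartition e)
    (eta_in_box : forall u, u \in hdiagram eta ->
       forall l : 'I_e.+1, (tnth u l < n (lift ord0 l))%N) :
  let rhos := [set rho : hpartition e.+1 | (hshape rho `<=` hdiagram eta)%fset]%classic in
  let g rho := fps_of_mpoly (grothendieck R n rho) in
  fps_summable rhos g /\
  fps_sum rhos g =
    \prod_(u <- prism (n ord0) (hdiagram eta))
      (1 - fps_of_mpoly (\prod_(k < e.+2) xvar R n k (tnth u k)))^-1.
Proof.
move=> rhos g.
have prism_down := prism_down_closed (n1 := n ord0) (@hdiagram_down_closed _ eta).
have weight_summable := fps_summable_corner_weight R prism_down (ltn0Sn _).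
have slices_in := first_slice_prism_sub eta_in_box.
have gE rho (rho_in : rhos rho) := fps_of_grothendieck R eta_in_box rho_in.
split; first by apply: (eq_fps_summable gE); apply: fps_summable_fibers.
by rewrite (eq_fps_sum gE) fps_sum_fibers // fps_sum_corner_weight.
Qed.
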